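(* If $1\le N\le 16$, then there does not exist an antipodal $5$-design with $2N+1$ rational points for the Chebyshev measure $(1-t^2)^{-1/2}dt/\pi$ on $(-1,1)$.
   Context: An $m$-design with $n$ points for a probability measure $w(t)dt$ on an interval $I$ is a set of $n$ pairwise distinct points $x_1,\dots,x_n\in I$ with $\frac1n\sum_i f(x_i)=\int_I f(t)w(t)dt$ for every real polynomial $f$ of degree at most $m$. It is rational if all $x_i\in\mathbb{Q}$ and antipodal if $\{x_i\}=\{-x_i\}$. *)

(* Defs.v *)
From HB Require Import structures.
From mathcomp Require Import all_boot all_order all_algebra.
From mathcomp Require Import all_classical all_reals all_analysis.

Set Implicit Arguments.
Unset Strict Implicit.
Unset Printing Implicit Defensive.

Import Order.TTheory GRing.Theory Num.Theory.
Import numFieldNormedType.Exports.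

Local Open Scope classical_set_scope.
Local Open Scope ring_scope.

(* [size f <= m.+1] says that f has degree at most m.  The identity is stated
   in \bar R, so it cannot hold through a default value of the integral. *)
Definition is_design (R : realType) (I : interval R) (w : R -> R) (m n : nat)
    (x : 'I_n -> R) : Prop :=
  [/\ injective x,
      forall i, x i \in I &
      forall f : {poly R}, (size f <= m.+1)%N ->
        (((n%:R)^-1 * \sum_(i < n) f.[x i])%:E
         = \int[lebesgue_measure]_(t in [set` I]) (f.[t] * w t)%:E)%E].

Definition rational_points (R : realType) (n : nat) (x : 'I_n -> R) : Prop :=
  forall i, exists q : rat, x i = ratr q.

Definition antipodal (R : realType) (n : nat) (x : 'I_n -> R) : Prop :=
  range x = range (fun i => - x i).

Definition chebyshev_density (R : realType) (t : R) : R :=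
  (Num.sqrt (1 - t ^+ 2))^-1 / pi.

(* Main.v *)
Require Import Defs.
From HB Require Import structures.
From mathcomp Require Import all_boot all_order all_algebra.
From mathcomp Require Import all_classical all_reals all_analysis.
From mathcomp Require Import measurable_realfun zify ring lra.

(** Differentiating [p(t) * sqrt(1 - t^2)], which vanishes at both endpoints,
    shows that [p' (1 - t^2) - p t] has mean zero for the Chebyshev measure.
    Taking [p = t] and [p = t^3], the doubled positive points [y_i] of an
    antipodal 5-design with [n] points satisfy [sum y_i^2 = n] and
    [sum y_i^4 = 3 n].  Write [y_i = a_i / d] in lowest terms and let [k] be the
    number of odd [a_i]; squares are counted mod 4 and fourth powers mod 16
    by [k].  If [d] is odd then [n = k = 3 n] mod 4, impossible for [n] odd.
    If [d] is even then 16 divides [k], and [0 < k <= N <= 16] forces [k = 16]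
    with every [a_i] odd; writing [a_i^2 = 1 + 8 t_i], the first equation
    makes [sum t_i] even and the second makes it odd. *)

Set Implicit Arguments.
Unset Strict Implicit.
Unset Printing Implicit Defensive.

Import Order.TTheory GRing.Theory Num.Theory.
Import numFieldNormedType.Exports.

(** * Arithmetic modulo 4 and 16, and denominators *)

Lemma sqr_odd (a : nat) : odd a -> exists t, a ^ 2 = (8 * t).+1.
Proof.
move=> oa; exists (a./2.+1 * a./2)./2.
have : ~~ odd (a./2.+1 * a./2) by rewrite oddM /= andNb.
have := odd_double_half a; rewrite oa -mulnn; move: a./2 => h <- ev.
have := odd_double_half (h.+1 * h); rewrite (negbTE ev); nia.
Qed.

Lemma sum_sqr_mod4 (I : finType) (A : pred I) (a : I -> nat) :
  \sum_(i in A) a i ^ 2 = \sum_(i in A) odd (a i) %[mod 4].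
Proof.
elim/big_rec2: _ => // i y1 y2 _ IH.
rewrite -modnDm IH modnDm; apply/eqP; rewrite eqn_modDr; apply/eqP.
case oa: (odd (a i)); first by have [t ->] := sqr_odd oa; lia.
by rewrite -[a i]odd_double_half oa -mulnn; lia.
Qed.

(** An odd fourth power is [(1 + 8 t)^2], hence 1 mod 16; an even one is divisible by [2^4]. *)
Lemma sum_exp4_mod16 (I : finType) (A : pred I) (a : I -> nat) :
  \sum_(i in A) a i ^ 4 = \sum_(i in A) odd (a i) %[mod 16].
Proof.
elim/big_rec2: _ => // i y1 y2 _ IH.
rewrite -modnDm IH modnDm; apply/eqP; rewrite eqn_modDr; apply/eqP.
rewrite (expnM (a i) 2 2).
case oa: (odd (a i)).
  by have [t ->] := sqr_odd oa; rewrite -mulnn; lia.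
by rewrite -[a i]odd_double_half oa add0n -muln2 expnMn -mulnn; lia.
Qed.

(** Lowest terms are replaced by descent on [d]: if [d] and all [a i] are even, halving them gives a
    solution with a smaller denominator. *)
Lemma no_sum_sqr_exp4_solution (I : finType) (A : pred I) (a : I -> nat) (d m : nat) :
  #|A| <= 16 -> odd m -> 0 < d ->
  \sum_(i in A) a i ^ 2 = m * d ^ 2 ->
  \sum_(i in A) a i ^ 4 = 3 * m * d ^ 4 -> False.
Proof.
move=> cA om; elim/ltn_ind: d a => d IH a d0 s2 s4.
have k2 := sum_sqr_mod4 A a; have k4 := sum_exp4_mod16 A a.
have kA : \sum_(i in A) odd (a i) <= #|A|.
  by rewrite -sum1_card; apply: leq_sum => i _; case: odd.
move: k2 k4 kA; rewrite s2 s4.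
have [[u du]|[e de]] : (exists u, d ^ 2 = (8 * u).+1) \/ exists e, d = 2 * e.
  case od: (odd d); [left; exact: sqr_odd|right; exists d./2].
  by rewrite -[LHS]odd_double_half od mul2n.
  rewrite (expnM d 2 2) du -mulnn; move: (\sum_(i in A) _) => k k2 k4 _.
  have : m = k %[mod 4] by nia.
  have : 3 * m = k %[mod 4] by nia.
  lia.
subst d; have e0 : 0 < e by lia.
move=> _ k4 kA.
have {k4} : 16 %| \sum_(i in A) odd (a i).
  by apply/eqP; rewrite -k4 expnMn mulnCA modnMr.
have [k0|k0] := posnP (\sum_(i in A) odd (a i)).
  move=> _; have ev i : i \in A -> a i = 2 * (a i)./2.
    move=> Ai; move/eqP: k0; rewrite sum_nat_eq0 => /forall_inP /(_ i Ai).
    by rewrite eqb0 mul2n => /negbTE oi; rewrite -[LHS]odd_double_half oi.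
  apply: (IH e _ (fun i => (a i)./2)) => //; first lia.
  - have : 4 * \sum_(i in A) (a i)./2 ^ 2 = 4 * (m * e ^ 2).
      rewrite big_distrr /= mulnCA -(expnMn 2 e 2) -s2; apply: eq_bigr => i Ai.
      by rewrite [in RHS]ev// expnMn.
    lia.
  - have : 16 * \sum_(i in A) (a i)./2 ^ 4 = 16 * (3 * m * e ^ 4).
      rewrite big_distrr /= mulnCA -(expnMn 2 e 4) -s4; apply: eq_bigr => i Ai.
      by rewrite [in RHS]ev// expnMn.
    lia.
(* A positive multiple of 16 bounded by [#|A| <= 16] makes both bounds equalities, so no [a i] with
   [i] in [A] is even. *)
move=> /dvdn_leq -/(_ k0) k16.
have A16 : #|A| = 16 by lia.
have odA i : i \in A -> odd (a i).
  move=> Ai; apply/negPn/negP => ei; move: k16; rewrite leqNgt => /negP; apply.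
  rewrite -A16 -sum1_card (bigD1 i Ai) /= [X in _ < X](bigD1 i Ai) /=.
  rewrite (negbTE ei) add0n add1n ltnS.
  by apply: leq_sum => j _; case: odd.
pose t i := (a i ^ 2).-1 %/ 8.
have tE i : i \in A -> a i ^ 2 = 1 + 8 * t i.
  by move=> /odA/sqr_odd[u]; rewrite /t => ->; lia.
have s2' : 16 + 8 * \sum_(i in A) t i = 4 * (m * e ^ 2).
  rewrite mulnCA -(expnMn 2 e 2) -s2 -A16 -sum1_card big_distrr -big_split /=.
  by apply: eq_bigr => i /tE ->.
have s4' : 16 + 16 * \sum_(i in A) t i + 64 * \sum_(i in A) t i ^ 2
           = 16 * (3 * m * e ^ 4).
  rewrite mulnCA -(expnMn 2 e 4) -s4 -{1}A16 -sum1_card !big_distrr -!big_split /=.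
  apply: eq_bigr => i /tE; rewrite (expnM (a i) 2 2) => ->; rewrite -!mulnn; lia.
(* Dividing [s2'] by 4 shows that [m * e ^ 2] is even, and [m] is odd. *)
have [f ef] : exists f, e = 2 * f.
  exists e./2; rewrite -[LHS]odd_double_half mul2n.
  case oe: (odd e) => //.
  have : odd (m * e ^ 2) by rewrite oddM om oddX oe.
  lia.
(* After division by 8, [s2'] makes the sum of the [t i] even; after division by 16, [s4'] makes it
   odd. *)
move: s2' s4'; rewrite ef !expnMn; lia.
Qed.

Local Open Scope classical_set_scope.
Local Open Scope ring_scope.

(** The product of all denominators serves; it need not be the least one, since the descent takes
    care of common factors 2. *)
Lemma common_denominator (I : finType) (q : I -> rat) :
  exists2 d : nat, (0 < d)%N & forall i, exists a : int, q i * d%:R = a%:~R.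
Proof.
have Dp i : 0 < denq (q i) by exact: denq_gt0.
exists (absz (\prod_i denq (q i))).
  by rewrite absz_gt0; apply/prodf_neq0 => i _; exact: denq_neq0.
move=> i; exists (numq (q i) * \prod_(j | j != i) denq (q j)).
rewrite pmulrn gez0_abs; last by apply: prodr_ge0 => j _; exact: ltW.
by rewrite (bigD1 i)//= !rmorphM /= mulrA numqE.
Qed.

(** * The fundamental theorem of calculus on an open interval *)

Lemma integral_derive_itvoo (R : realType) (f F : R -> R) (a b : R) :
  a < b -> {in `]a, b[, continuous f} ->
  derivable_oo_LRcontinuous F a b -> {in `]a, b[, derive1 F =1 f} ->
  lebesgue_measure.-integrable `]a, b[ (EFin \o f) ->
  (\int[lebesgue_measure]_(x in `]a, b[) (f x)%:E = (F b)%:E - (F a)%:E)%E.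
Proof.
(* Since [f] may blow up at the endpoints, the theorem is applied on compact intervals [J n]
   exhausting []a, b[]; dominated convergence, with [|f|] as the bound, gives the limit. *)
move=> ab cf [dF Fa Fb] F'f intf.
set mu := lebesgue_measure.
(* This is [(b - a) / (n + 3)]; the shift by 2 keeps [e n + e n] below [b - a], so that [J n] is
   nondegenerate from [n = 0] on. *)
pose e n : R := (b - a) * harmonic (n + 2)%N.
have e0 n : 0 < e n by rewrite mulr_gt0 ?subr_gt0 ?harmonic_gt0.
have e2 n : e n + e n < b - a.
  rewrite -mulr2n -mulr_natr -mulrA gtr_pMr ?subr_gt0//.
  by rewrite /harmonic /= addn2 ltr_pdivrMl// mulr1 ltr_nat.
have ecvg : e @ \oo --> (0 : R).
  rewrite -[X in _ --> X](mulr0 (b - a)); apply: cvgM; first exact: cvg_cst.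
  by rewrite (cvg_shiftn 2 (@harmonic R)); exact: cvg_harmonic.
have Fan : F (a + e n) @[n --> \oo] --> F a.
  move/cvg_at_rightP : Fa; apply; split; first by move=> n; rewrite ltrDl.
  by rewrite -[X in _ --> X]addr0; apply: cvgD => //; exact: cvg_cst.
have Fbn : F (b - e n) @[n --> \oo] --> F b.
  move/cvg_at_leftP : Fb; apply; split; first by move=> n; rewrite ltrBlDr ltrDl.
  by rewrite -[X in _ --> X]subr0; apply: cvgB => //; exact: cvg_cst.
pose J n : set R := `[a + e n, b - e n]%classic.
have sJ n : J n `<=` `]a, b[%classic.
  move=> x; rewrite /J /= !in_itv/= => /andP[x1 x2].
  have := e0 n => en; apply/andP; split; lra.
pose f_ n := EFin \o (f \_ (J n)).
have FTCn n : (\int[mu]_(x in `]a, b[) f_ n x = (F (b - e n) - F (a + e n))%:E)%E.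
  rewrite /f_ -restrict_EFin -integral_mkcondr setIidr//.
  rewrite (@continuous_FTC2 _ _ F)//.
  - by have := e2 n; lra.
  - apply: continuous_in_subspaceT => x xJ; apply: cf.
    by move: xJ; rewrite inE => /sJ.
  - have aI : a + e n \in `]a, b[.
      by rewrite in_itv/=; have := e0 n; have := e2 n => *; apply/andP; split; lra.
    have bI : b - e n \in `]a, b[.
      by rewrite in_itv/=; have := e0 n; have := e2 n => *; apply/andP; split; lra.
    have FC x : x \in `]a, b[ -> {for x, continuous F}.
      by move=> xI; apply/differentiable_continuous/derivable1_diffP/dF.
    split.
    + move=> x xI; exact: dF (sJ n _ (subset_itv_oo_cc xI)).
    + exact/cvg_at_right_filter/FC.
    + exact/cvg_at_left_filter/FC.
  - move=> x xI; exact: F'f (sJ n _ (subset_itv_oo_cc xI)).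
have mf := measurable_int _ intf.
have [|||_ _ cv] := @dominated_convergence _ _ _ mu `]a, b[%classic
  (measurable_itv _) f_ (EFin \o f) (abse \o (EFin \o f)) _ mf _ (integrable_abse intf).
- move=> n; apply/measurable_EFinP; apply/measurable_restrict => //.
    exact: measurable_itv.
  have mf' : measurable_fun `]a, b[ f by exact/measurable_EFinP.
  exact: measurable_funS (measurable_itv _) (@subIsetl _ _ _) mf'.
(* Each [x] lies in [J n] for all large [n], so [f_ n x] is eventually constant. *)
- apply: aeW => x /=; rewrite in_itv/= => /andP[]; rewrite -subr_gt0 => ax.
  rewrite -subr_gt0 => xb; apply: cvg_near_cst; near=> n.
  have ea : e n < x - a by near: n; exact: (cvgr_lt _ ecvg).
  have eb : e n < b - x by near: n; exact: (cvgr_lt _ ecvg).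
  rewrite /f_ /= patchE mem_set// /J /= in_itv/=.
  by apply/andP; split; lra.
- apply: aeW => x n _ /=; rewrite /f_ /= patchE.
  by case: ifP => // _; rewrite lee_fin normr0.
have : [sequence (\int[mu]_(x in `]a, b[) f_ n x)%E]_n @ \oo --> (F b - F a)%:E.
  rewrite (_ : [sequence _]_n = fun n => (F (b - e n) - F (a + e n))%:E).
    by apply: cvg_EFin; [exact: nearW|exact: cvgB].
  by apply/funext => n; exact: FTCn.
by rewrite -EFinB; exact: (cvg_unique _ cv).
Unshelve. all: by end_near. Qed.

(** * Chebyshev moments and the power sums of a design *)

Lemma chebyshev_density_ge0 (R : realType) (t : R) : 0 <= chebyshev_density t.
Proof. by rewrite mulr_ge0 ?invr_ge0 ?sqrtr_ge0 ?pi_ge0. Qed.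

Lemma subr_sqr_gt0 (R : realType) (t : R) : t \in `]-1, 1[ -> 0 < 1 - t ^+ 2.
Proof. by rewrite in_itv/= => /andP[? ?]; nra. Qed.

Lemma continuous_chebyshev_density (R : realType) :
  {in `]-1, 1[, continuous (@chebyshev_density R)}.
Proof.
move=> t /subr_sqr_gt0 t1; apply: cvgM; last exact: cvg_cst.
apply: cvgV; first by rewrite gt_eqF ?sqrtr_gt0.
apply: (@continuous_comp _ _ _ (fun t : R => 1 - t ^+ 2) Num.sqrt).
  by apply: cvgB; [exact: cvg_cst|exact: exprn_continuous].
exact: sqrt_continuous.
Qed.

Lemma horner_norm_le (R : realType) (p : {poly R}) (t : R) :
  `|t| <= 1 -> `|p.[t]| <= \sum_(i < size p) `|p`_i|.
Proof.
move=> t1; rewrite horner_coef; apply: le_trans (ler_norm_sum _ _ _) _.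
by apply: ler_sum => i _; rewrite normrM normrX ler_piMr// exprn_ile1.
Qed.

Lemma integrable_horner_chebyshev (R : realType) (p : {poly R}) :
  lebesgue_measure.-integrable `]-1, 1[ (EFin \o @chebyshev_density R) ->
  lebesgue_measure.-integrable `]-1, 1[
    (EFin \o (fun t => p.[t] * chebyshev_density t)).
Proof.
move=> iw.
suff : lebesgue_measure.-integrable `]-1, 1[
    ((EFin \o horner p) \* (EFin \o @chebyshev_density R))%E by [].
apply: integrableMr => //.
  exact: (@measurable_poly R p).
exists (\sum_(i < size p) `|p`_i|); split; first exact: num_real.
move=> M ltM t /=; rewrite in_itv/= => /andP[t1 t2].
by apply: le_trans (ltW ltM); apply: horner_norm_le; rewrite ler_norml !ltW.
Qed.

Lemma chebyshev_integral_eq0 (R : realType) (p : {poly R}) :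
  lebesgue_measure.-integrable `]-1, 1[ (EFin \o @chebyshev_density R) ->
  (\int[lebesgue_measure]_(t in [set` `]-1, 1[%R])
     ((p^`() * (1 - 'X^2) - p * 'X).[t] * chebyshev_density t)%:E = 0)%E.
Proof.
move=> iw; set q := p^`() * _ - _.
pose F (t : R) : R := p.[t] * Num.sqrt (1 - t ^+ 2) / pi.
have cF : continuous F.
  move=> t; apply: cvgM; last exact: cvg_cst.
  apply: cvgM; first exact: continuous_horner.
  apply: (@continuous_comp _ _ _ (fun t : R => 1 - t ^+ 2) Num.sqrt).
    by apply: cvgB; [exact: cvg_cst|exact: exprn_continuous].
  exact: sqrt_continuous.
have dF (t : R) : t \in `]-1, 1[ ->
    is_derive t 1 F (q.[t] * chebyshev_density t).
  move=> /subr_sqr_gt0 t1.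
  have dsq : is_derive t 1 (fun t : R => Num.sqrt (1 - t ^+ 2))
               (- t / Num.sqrt (1 - t ^+ 2)).
    have d1 : is_derive t 1 (fun t : R => 1 - t ^+ 2) (- (t *+ 2)).
      apply: is_derive_eq.
      by rewrite add0r mul1r [_%:A]mulr1 mulr2n.
    have := @is_derive1_comp R Num.sqrt _ t _ _ (is_derive1_sqrt t1) d1.
    congr (is_derive _ _ _ _).
    rewrite invfM; have : Num.sqrt (1 - t ^+ 2) != 0 by rewrite gt_eqF ?sqrtr_gt0.
    by move: (Num.sqrt _) => s s0; field.
  have /= := is_deriveM (is_deriveM (is_derive_poly p t) dsq)
    (is_derive_cst (pi^-1 : R) t 1).
  congr (is_derive _ _ _ _).
  rewrite /chebyshev_density /q !hornerE -![_ *: _]/(_ * _) /=.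
  have : Num.sqrt (1 - t ^+ 2) != 0 by rewrite gt_eqF ?sqrtr_gt0.
  have := sqr_sqrtr (ltW t1).
  have : pi != 0 :> R by rewrite gt_eqF ?pi_gt0.
  move: (Num.sqrt _) (pi : R) => s c c0 s2 s0.
  rewrite mulr0 add0r -s2.
  by field; rewrite c0.
rewrite (@integral_derive_itvoo _ _ F)//.
(* Both boundary terms contain [sqrt 0]. *)
- by rewrite /F !expr2 mulrNN mulr1 subrr sqrtr0 !mulr0 !mul0r sube0.
- move=> t tI; apply: cvgM; first exact: continuous_horner.
  exact: continuous_chebyshev_density.
- split.
  + by move=> t /dF [].
  + exact/cvg_at_right_filter/cF.
  + exact/cvg_at_left_filter/cF.
- by move=> t /dF dFt; rewrite derive1E derive_val.
- exact: integrable_horner_chebyshev.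
Qed.

Lemma chebyshev_design_power_sums (R : realType) (n : nat) (x : 'I_n -> R) :
  (0 < n)%N -> is_design `]-1, 1[ (@chebyshev_density R) 5 x ->
  \sum_i x i ^+ 2 = n%:R / 2 /\ \sum_i x i ^+ 4 = n%:R * 3 / 8.
Proof.
move=> n0 [_ _ D].
have nn0 : (n%:R)^-1 != 0 :> R by rewrite invr_eq0 pnatr_eq0 -lt0n.
have iw : lebesgue_measure.-integrable `]-1, 1[ (EFin \o @chebyshev_density R).
  apply/integrableP; split.
    have mw : measurable_fun (`]-1, 1[ : set R) (@chebyshev_density R).
      apply: open_continuous_measurable_fun; first exact: interval_open.
      by move=> t /set_mem; exact: continuous_chebyshev_density.
    exact/measurable_EFinP.
  (* Integrability comes from the design itself: its identity for the constant 1 equates the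
     integral of the nonnegative density with a real number, so the integral is finite. *)
  have := D 1; rewrite size_poly1 => /(_ isT) D1.
  under eq_integral => t _ do
    rewrite /= ger0_norm ?chebyshev_density_ge0//
      -[chebyshev_density t]mul1r -(hornerC 1 t).
  by rewrite -D1 ltry.
have D0 (p : {poly R}) : (size (p^`() * (1 - 'X^2) - p * 'X)%R <= 6)%N ->
    \sum_i (p^`() * (1 - 'X^2) - p * 'X).[x i] = 0.
  move=> sp; have := D _ sp; rewrite chebyshev_integral_eq0// => -[] /eqP.
  by rewrite mulf_eq0 (negbTE nn0) => /eqP.
(* The mean-zero polynomials are [1 - 2 X^2] and [3 X^2 - 4 X^4]: the first fixes the sum of
   squares, the second then the sum of fourth powers. *)
have := D0 'X; have := D0 'X^3.
have -> : ('X : {poly R})^`() * (1 - 'X^2) - 'X * 'X = 1 - 'X^2 *+ 2.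
  by rewrite derivX; ring.
have -> : ('X^3 : {poly R})^`() * (1 - 'X^2) - 'X^3 * 'X = 'X^2 *+ 3 - 'X^4 *+ 4.
  by rewrite derivXn; ring.
have szn (a b : nat) : (a <= 5 -> size ('X^a *+ b : {poly R}) <= 6)%N.
  move=> a5; rewrite -scaler_nat; apply: leq_trans (size_scale_leq _ _) _.
  by rewrite size_polyXn.
have szB (p q : {poly R}) : (size p <= 6 -> size q <= 6 -> size (p - q)%R <= 6)%N.
  by move=> sp sq; apply: leq_trans (size_polyD _ _) _; rewrite size_polyN geq_max sp.
move=> /(_ (szB _ _ (szn 2 3 isT) (szn 4 4 isT))%N) e4.
have s1 : (size (1%R : {poly R}) <= 6)%N by rewrite size_poly1.
move=> /(_ (szB _ _ s1 (szn 2 2 isT))%N) e2.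
move: e2 e4.
under eq_bigr do rewrite hornerD hornerN hornerMn hornerXn -polyC1 hornerC.
under [X in _ -> X = _ -> _]eq_bigr do rewrite hornerD hornerN !hornerMn !hornerXn.
rewrite !sumrB !sumrMnl sumr_const card_ord.
move: (\sum_i _) (\sum_i _) => s2 s4 ? ?; split; lra.
Qed.

(** * Reduction to the positive points and conclusion *)

Lemma antipodal_sum (R : realType) (n : nat) (x : 'I_n -> R) (g : R -> R) :
  injective x -> antipodal x -> (forall t, g (- t) = g t) -> g 0 = 0 ->
  \sum_i g (x i) = (\sum_(i | 0 < x i) g (x i)) *+ 2.
Proof.
move=> xinj xanti gN g0.
(* Negation of points induces a permutation [s] of the indices; it carries the negative points to
   the positive ones, while a point 0 contributes [g 0 = 0]. *)
have /choice[s xs] i : exists j, x j = - x i.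
  have : range (fun i => - x i) (- x i) by exists i.
  by rewrite -xanti => -[j _ <-]; exists j.
have sinj : injective s.
  by move=> i j sij; apply/xinj/oppr_inj; rewrite -!xs sij.
rewrite (bigID (fun i => 0 < x i)) /= mulr2n; congr (_ + _).
rewrite [RHS](reindex_inj sinj) /= (bigID (fun i => x i == 0)) /=.
rewrite big1 ?add0r => [|i /andP[_ /eqP ->]//].
apply: eq_big => [i|i _]; last by rewrite xs gN.
by rewrite xs oppr_gt0 -leNgt lt_neqAle andbC.
Qed.

Theorem theorem8p1 (R : realType) (N : nat) (hN : (1 <= N <= 16)%N) :
  ~ exists x : 'I_(2 * N + 1) -> R,
      [/\ is_design `]-1, 1[ (@chebyshev_density R) 5 x,
          rational_points x &
          antipodal x].
Proof.
move=> [x [xD /choice[q xq] xanti]].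
have [xinj _ _] := xD.
have [|s2 s4] := chebyshev_design_power_sums _ xD; first by rewrite addn1.
set n := (2 * N + 1)%N in x xD q xq xanti xinj s2 s4 *.
move: s2; rewrite (antipodal_sum (g := fun t => t ^+ 2))//; last 2 first.
- by move=> t; rewrite sqrrN.
- by rewrite expr0n.
move: s4; rewrite (antipodal_sum (g := fun t => t ^+ 4))//; last 2 first.
- by move=> t; rewrite exprNn -signr_odd mul1r.
- by rewrite expr0n.
move=> s4 s2.
have [d d0 /choice[a qa]] := common_denominator q.
have dR : d%:R != 0 :> R by rewrite pnatr_eq0 -lt0n.
have xa i : x i = (a i)%:~R / d%:R.
  apply/(canRL (mulfK dR)).
  by rewrite xq -(ratr_nat R) -rmorphM/= qa ratr_int.
pose A := [pred i | 0 < x i].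
have aE i : i \in A -> (2 * absz (a i))%:R = 2 * (x i * d%:R) :> R.
  rewrite inE xa divfK// natrM natr_absz pmulr_lgt0 ?invr_gt0 ?ltr0n//.
  by move=> a0; rewrite intr_norm gtr0_norm.
(* Over the positive points the power sums are [n / 4] and [3 n / 16]; the factor 2 turns them into
   [n] and [3 n]. *)
apply: (@no_sum_sqr_exp4_solution _ A (fun i => 2 * absz (a i))%N d n) => //.
- have half_le16 k : (k * 2 <= n -> k <= 16)%N by rewrite /n; lia.
  (* Summing the indicator of nonzero points counts [2 #|A|] of them among the [2 N + 1] points,
     whence [#|A| <= N]. *)
  have := antipodal_sum (g := fun t : R => (t != 0)%:R) xinj xanti.
  rewrite eqxx => /(_ _ erefl) H.
  have {}H := H (fun t => congr1 (fun b : bool => (~~ b)%:R) (oppr_eq0 t)).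
  have : (#|A| * 2)%:R <= n%:R :> R.
    rewrite natrM mulr_natr -sum1_card natr_sum.
    rewrite (_ : \sum_(i in A) _ = \sum_(i | 0 < x i) (x i != 0)%:R); last first.
      by apply: eq_bigr => i; rewrite inE => /gt_eqF ->.
    rewrite -H -[n in leRHS]card_ord -sum1_card natr_sum; apply: ler_sum => i _.
    by case: (_ != _); rewrite ?ler01.
  by rewrite ler_nat; exact: half_le16.
- by rewrite /n; lia.
(* The equation between naturals is checked in [R], where the cast is injective. *)
- apply: (@mulrIn R 1) => //; rewrite natr_sum natrM natrX.
  under eq_bigr => i Ai do rewrite natrX (aE i Ai) !exprMn.
  rewrite -mulr_sumr -mulr_suml.
  rewrite (eq_bigl (fun i => 0 < x i))//.
  by rewrite (_ : \sum_(i | _) _ = n%:R / 4); [field|lra].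
- apply: (@mulrIn R 1) => //; rewrite natr_sum 2!natrM natrX.
  under eq_bigr => i Ai do rewrite natrX (aE i Ai) !exprMn.
  rewrite -mulr_sumr -mulr_suml.
  rewrite (eq_bigl (fun i => 0 < x i))//.
  by rewrite (_ : \sum_(i | _) _ = n%:R * 3 / 16); [field|lra].
Qed.
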